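(* Assume that the virtual cell volumes, virtual face moments and data transfer operator satisfy: (T.1) $\mu_i>0$ for all $i$, $\mu_i=O(h_X^d)$, and $\sum_i\mu_i=\mu(\Omega)$ (the measure of $\Omega$); (T.2) $\bm{\mu}_{ij}=-\bm{\mu}_{ji}$ for every virtual face $\bm{f}_{ij}$; (T.3) $\bm{t}_{ij}(\bm{u}^h)=\bm{t}_{ji}(\bm{u}^h)$ for every virtual face $\bm{f}_{ij}$ and every $\bm{u}^h\in U^h_\gamma$. Then the abstract meshfree mimetic divergence operator $DIV$ has the following two properties. (Local conservation) For every set $C_\omega\subseteq V$ of virtual cell indices and every $\bm{u}^h\in U^h_\gamma$, $$\sum_{i\in C_\omega}\mu_i(DIV\,\bm{u}^h)_i=\sum_{\substack{i\in C_\omega,\ j\in V_i\\ j\notin C_\omega}}\bm{t}_{ij}(\bm{u}^h)\cdot\bm{\mu}_{ij}+\sum_{\substack{k\in C_\omega\\ \Gamma_k\subseteq\gamma'}}\bm{t}_{\Gamma_k}(\bm{u}^h)\cdot\bm{\mu}_{\Gamma_k}+\sum_{\substack{k\in C_\omega\\ \Gamma_k\subseteq\gamma}}\int_{\Gamma_k}\bm{u}\cdot\bm{n}_k\,dS .$$ (Global conservation) If $\gamma=\Gamma$, then $$\sum_{i\in V}\mu_i(DIV\,\bm{u}^h)_i=\int_\Gamma\bm{u}\cdot\bm{n}\,dS .$$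
   Context: $\Omega\subset\mathbb{R}^d$, $d=2,3$, is a bounded connected region with Lipschitz boundary $\Gamma$, partitioned into finitely many faces (boundary segments) $\Gamma_j$ that are disjoint up to sets of zero surface measure, with centroids $\bm{x}_j$ and outward unit normals $\bm{n}_j$; $\bm{n}$ is the outward unit normal on $\Gamma$. The set $X_\Gamma$ consists of these centroids, $X_0$ is a finite set of interior points of $\Omega$, and the point cloud is $X=X_0\cup X_\Gamma$. Its fill distance is $h_X=\sup_{\bm{x}\in\Omega}\min_{\bm{x}_i\in X}|\bm{x}-\bm{x}_i|$. $\Gamma$ is split into $\gamma$ and $\gamma'=\Gamma\setminus\gamma$, each an exact union of segments $\Gamma_j$. $U^h_\gamma$ is the space of discrete vector fields $\bm{u}^h=\{\bm{u}_i\in\mathbb{R}^d: \bm{x}_i\in X_0\cup X_{\gamma'}\}$, $X_{\gamma'}=X\cap\gamma'$; on $\gamma$ the (integrable) values of a vector field $\bm{u}$ are prescribed. Virtual mesh: the virtual vertex set $V$ is the index set of $X$. $E\subseteq V\times V$ is a symmetric set of ordered pairs $(i,j)$, $i\ne j$ (virtual edges), and $V_i=\{j:(i,j)\in E\}$. To each $i\in V$ is associated a virtual dual cell $\omega_i$ and to each $(i,j)\in E$ a virtual dual face $\bm{f}_{ij}$ (with $\bm{f}_{ij}$ and $\bm{f}_{ji}$ being the same face with opposite orientation). The virtual boundary of $\omega_i$ consists of the faces $\bm{f}_{ij}$, $j\in V_i$, together with the segment $\Gamma_i$ if $\bm{x}_i\in X_\Gamma$. Virtual data: for a fixed integer $n_F\ge1$,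 there are virtual cell volumes $\mu_i\in\mathbb{R}$ ($i\in V$), virtual face moments $\bm{\mu}_{ij}\in\mathbb{R}^{n_F}$ ($(i,j)\in E$) and $\bm{\mu}_{\Gamma_i}\in\mathbb{R}^{n_F}$ ($\Gamma_i\subseteq\gamma'$). A data transfer operator $T_F$ assigns to $\bm{u}^h\in U^h_\gamma$ field moments $\bm{t}_{ij}(\bm{u}^h)\in\mathbb{R}^{n_F}$ for $(i,j)\in E$ and $\bm{t}_{\Gamma_i}(\bm{u}^h)\in\mathbb{R}^{n_F}$ for $\Gamma_i\subseteq\gamma'$. The abstract meshfree mimetic divergence (MMD) operator is $$(DIV\,\bm{u}^h)_i=\frac1{\mu_i}\Big[\sum_{j\in V_i}\bm{t}_{ij}(\bm{u}^h)\cdot\bm{\mu}_{ij}+\bm{t}_{\chi_i(\gamma')}(\bm{u}^h)\cdot\bm{\mu}_{\chi_i(\gamma')}+\int_{\chi_i(\gamma)}\bm{u}\cdot\bm{n}\,dS\Big],\quad i\in V,$$ where $\chi_i(\gamma')=\Gamma_i$ if $\bm{x}_i\in\gamma'$ and $\emptyset$ otherwise, and similarly for $\chi_i(\gamma)$; terms indexed by $\emptyset$ are zero.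
   Formalization: Each centroid x_j is assumed to lie in its own boundary segment Γ_j; without this (e.g. an annular face whose centroid is interior to Ω) the test ''x_i in γ'' drops that face's flux from DIV and the conservation laws fail. *)

(* Defs.v *)
From HB Require Import structures.
From mathcomp Require Import all_boot all_order all_algebra.
From mathcomp Require Import all_classical all_reals all_analysis.
Set Implicit Arguments.
Unset Strict Implicit.
Unset Printing Implicit Defensive.
Import Order.TTheory GRing.Theory Num.Theory.
Import numFieldNormedType.Exports.
Local Open Scope classical_set_scope.
Local Open Scope ring_scope.

Section euclidean.
Context {R : realType}.

Definition dotv {n : nat} (v w : 'rV[R]_n) : R := \sum_(j < n) v 0 j * w 0 j.

(* The library norm of 'rV[R]_n is the maximum norm. *)
Definition enorm {n : nat} (v : 'rV[R]_n) : R := Num.sqrt (dotv v v).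

Definition ediam {n : nat} (A : set 'rV[R]_n) : \bar R :=
  ereal_sup [set (enorm (p.1 - p.2))%:E | p in A `*` A].

(* omega_s = pi^(s/2) / Gamma(s/2 + 1), the volume of the unit ball of R^s *)
Fixpoint unit_ball_volume (s : nat) : R :=
  match s with
  | 0 => 1
  | 1 => 2
  | s'.+2 => 2 * pi / s%:R * unit_ball_volume s'
  end.

Lemma unit_ball_volume_ge0 s : 0 <= unit_ball_volume s.
Proof.
suff: 0 <= unit_ball_volume s /\ 0 <= unit_ball_volume s.+1 by case.
elim: s => [|s [h1 h2]]; split => //=; rewrite ?ler01 ?ler0n//.
by rewrite mulr_ge0// divr_ge0// mulr_ge0 ?pi_ge0.
Qed.

Definition hausdorff_gauge {n : nat} (s : nat) (delta : R) (A : set 'rV[R]_n)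
    : \bar R :=
  if `[< A = set0 >] then 0%E
  else if (ediam A <= delta%:E)%E
    then (unit_ball_volume s * (fine (ediam A) / 2) ^+ s)%:E
    else +oo%E.

Definition cover_inf {T : Type} (c : set T -> \bar R) (A : set T) : \bar R :=
  ereal_inf [set (\sum_(k <oo) c (F k))%E
            | F in [set F : (set T)^nat | A `<=` \bigcup_k F k]].

(* s-dimensional Hausdorff outer measure of R^n, normalised so that it is the
   usual length for s = 1 and the usual area for s = 2 *)
Definition hausdorff {n : nat} (s : nat) (A : set 'rV[R]_n) : \bar R :=
  ereal_sup [set cover_inf (hausdorff_gauge s delta) A
            | delta in [set delta : R | 0 < delta]].

Definition lebesgue_outer {n : nat} (A : set 'rV[R]_n) : \bar R :=
  ereal_inf
    [set (\sum_(k <oo) (\prod_(j < n) ((p k).2 0 j - (p k).1 0 j))%:E)%E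
    | p in [set p : nat -> 'rV[R]_n * 'rV[R]_n |
        (forall k j, (p k).1 0 j <= (p k).2 0 j) /\
        A `<=` \bigcup_k [set y | forall j,
                           (p k).1 0 j <= y 0 j <= (p k).2 0 j]]].

End euclidean.

Section hausdorff_outer_measure.
Context {R : realType}.
Local Open Scope ereal_scope.

(* The discrete sigma-algebra, for which [mu_ext] is [cover_inf]. *)
Definition all_sets (T : Type) := T.
HB.instance Definition _ (T : pointedType) := Pointed.on (all_sets T).
HB.instance Definition _ (T : pointedType) :=
  @isMeasurable.Build default_measure_display (all_sets T) [set: set T]
    I (fun _ _ => I) (fun _ _ => I).

Lemma cover_infE (T : pointedType) (c : set T -> \bar R) :
  cover_inf c = mu_ext (c : set (all_sets T) -> \bar R).
Proof.
apply/funext => A; rewrite /cover_inf /mu_ext; congr ereal_inf.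
by apply/seteqP; split => x [F hF <-]; exists F => //; case: hF.
Qed.

Context (n s : nat).

Let gauge (delta : R) : set 'rV[R]_n -> \bar R := hausdorff_gauge s delta.

Let gauge0 delta : gauge delta set0 = 0.
Proof. by rewrite /gauge /hausdorff_gauge; case: asboolP. Qed.

Let gauge_ge0 delta A : 0 <= gauge delta A.
Proof.
rewrite /gauge /hausdorff_gauge; case: asboolP => // /eqP/set0P [x Ax].
case: ifP => // _; rewrite lee_fin mulr_ge0 ?unit_ball_volume_ge0//.
rewrite exprn_ge0// divr_ge0// fine_ge0//.
apply: ereal_sup_ubound; exists (x, x) => //=.
by rewrite subrr /enorm /dotv big1 ?sqrtr0// => j _; rewrite mxE mul0r.
Qed.

Lemma hausdorff0 : hausdorff s (set0 : set 'rV[R]_n) = 0.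
Proof.
apply/eqP; rewrite eq_le; apply/andP; split.
  apply: ge_ereal_sup => _ [delta _ <-].
  by rewrite cover_infE mu_ext0// => A; exact: gauge_ge0.
apply: ereal_sup_ubound; exists 1%R => //=.
by rewrite cover_infE mu_ext0// => A; exact: gauge_ge0.
Qed.

Lemma hausdorff_ge0 (A : set 'rV[R]_n) : 0 <= hausdorff s A.
Proof.
apply: (@le_trans _ _ (cover_inf (gauge 1%R) A)).
  by rewrite cover_infE mu_ext_ge0// => B; exact: gauge_ge0.
by apply: ereal_sup_ubound; exists 1%R => //=.
Qed.

Lemma le_hausdorff :
  {homo (hausdorff s : set 'rV[R]_n -> \bar R) : A B / A `<=` B >-> A <= B}.
Proof.
move=> A B AB; apply: ge_ereal_sup => _ [delta delta0 <-].
apply: (@le_trans _ _ (cover_inf (gauge delta) B)).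
  by rewrite cover_infE; exact: le_mu_ext.
by apply: ereal_sup_ubound; exists delta.
Qed.

Lemma hausdorff_sigma_subadditive :
  sigma_subadditive (hausdorff s : set 'rV[R]_n -> \bar R).
Proof.
move=> F; apply: ge_ereal_sup => _ [delta delta0 <-].
apply: (@le_trans _ _ (\sum_(k <oo) cover_inf (gauge delta) (F k))).
  by rewrite cover_infE; apply: mu_ext_sigma_subadditive => A; exact: gauge_ge0.
apply: lee_nneseries => k *.
  by rewrite cover_infE mu_ext_ge0// => A; exact: gauge_ge0.
by apply: ereal_sup_ubound; exists delta.
Qed.

HB.instance Definition _ := isOuterMeasure.Build R 'rV[R]_n
  (@hausdorff R n s) hausdorff0 hausdorff_ge0 le_hausdorff
  hausdorff_sigma_subadditive.

End hausdorff_outer_measure.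

Definition surface_outer_measure (R : realType) (d : nat) :
  {outer_measure set 'rV[R]_d -> \bar R} := @hausdorff R d d.-1.

(* R^d with the sigma-algebra of H^(d-1)-measurable sets *)
Notation surf_space R d := (caratheodory_type (surface_outer_measure R d)).

Definition surface_measure (R : realType) (d : nat) :
  {measure set (surf_space R d) -> \bar R} :=
  (surface_outer_measure R d : set (surf_space R d) -> \bar R).

Section domain.
Context {R : realType} {d : nat}.
Implicit Types (Omega A : set 'rV[R]_d) (y z nu : 'rV[R]_d).

Definition bdry A : set 'rV[R]_d := closure A `\` interior A.

(* Near each boundary point, Omega lies below the graph, over the hyperplane
   orthogonal to a unit vector e, of a Lipschitz function phi. *)
Definition lipschitz_boundary Omega : Prop :=
  forall p, bdry Omega p ->
  exists (e : 'rV[R]_d) (phi : 'rV[R]_d -> R) (K r : R),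
    [/\ enorm e = 1, 0 < r,
        forall y z, `|phi y - phi z| <= K * enorm (y - z) &
        forall y, enorm (y - p) < r ->
          (Omega y <-> dotv y e < phi (y - dotv y e *: e))].

Definition lipschitz_region Omega : Prop :=
  [/\ open Omega, Omega !=set0, connected Omega, bounded_set Omega &
      lipschitz_boundary Omega].

(* Near y, Omega is the half-space opposite to nu, up to a double cone of
   arbitrarily small opening around the tangent hyperplane; where the local
   graph function phi is differentiable, i.e. at almost every boundary point,
   this means nu = (e - grad phi) / |e - grad phi|. *)
Definition outward_unit_normal Omega y nu : Prop :=
  enorm nu = 1 /\
  forall eps : R, 0 < eps -> exists2 r : R, 0 < r &
    forall z, enorm (z - y) < r ->
      (dotv (z - y) nu < - (eps * enorm (z - y)) -> Omega z) /\
      (eps * enorm (z - y) < dotv (z - y) nu -> ~ Omega z).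

Definition normal_field Omega A (n : 'rV[R]_d -> 'rV[R]_d) : Prop :=
  {ae surface_measure R d, forall y, A y -> outward_unit_normal Omega y (n y)}.

Definition surf_integral (A : set 'rV[R]_d) (f : 'rV[R]_d -> R) : R :=
  (\int[surface_measure R d]_(y in A) f y)%R.

Definition is_centroid (A : set 'rV[R]_d) (c : 'rV[R]_d) : Prop :=
  (0 < surface_measure R d A < +oo)%E /\
  forall j, c 0 j =
    (fine (surface_measure R d A))^-1 * surf_integral A (fun y => y 0 j).

End domain.

Section point_clouds.
Context {R : realType} {d : nat}.

(* The index set [vert] is the virtual vertex set V. Boundary points and faces
   share their indices: for i in [bnd], x_i is the centroid of Gamma_i, and
   [face i] and [face_normal i] are irrelevant otherwise. *)
Record point_cloud (Omega : set 'rV[R]_d) := PointCloud {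
  vert : finType;
  pt : vert -> 'rV[R]_d;
  bnd : {set vert};
  face : vert -> set 'rV[R]_d;
  face_normal : vert -> 'rV[R]_d -> 'rV[R]_d;
  pt_inj : injective pt;
  pt_interior : forall i, i \notin bnd -> Omega (pt i);
  faces_cover : bdry Omega = \bigcup_(i in [set` bnd]) face i;
  face_measurable : forall i, i \in bnd ->
    measurable (face i : set (surf_space R d));
  faces_disjoint : forall i j, i \in bnd -> j \in bnd -> i != j ->
    surface_measure R d (face i `&` face j) = 0%E;
  face_centroid : forall i, i \in bnd -> is_centroid (face i) (pt i);
  centroid_in_face : forall i, i \in bnd -> face i (pt i);
  face_normalP : forall i, i \in bnd ->
    normal_field Omega (face i) (face_normal i) }.

Definition fill_distance Omega (X : point_cloud Omega) : R :=
  sup [set inf [set enorm (y - pt i) | i in [set: vert X]] | y in Omega].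

Definition union_of_faces Omega (X : point_cloud Omega) (A : set 'rV[R]_d) :=
  exists2 J : {set vert X}, J \subset bnd X &
    A = \bigcup_(i in [set` J]) face i.

Definition compl_part (Omega gamma : set 'rV[R]_d) : set 'rV[R]_d :=
  bdry Omega `\` gamma.

Definition splits_boundary Omega (X : point_cloud Omega) (gamma : set 'rV[R]_d)
    : Prop :=
  [/\ gamma `<=` bdry Omega, union_of_faces X gamma &
      union_of_faces X (compl_part Omega gamma)].

Definition chi Omega (X : point_cloud Omega) (i : vert X) (A : set 'rV[R]_d)
    : set 'rV[R]_d :=
  if `[< A (pt i) >] then face i else set0.

Definition discrete_field Omega (X : point_cloud Omega)
    (gamma : set 'rV[R]_d) : Type :=
  {i : vert X | (i \notin bnd X) || `[< compl_part Omega gamma (pt i) >]} ->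
  'rV[R]_d.

(* The dual cells omega_i and dual faces f_ij carry no geometry: they are
   represented by their indices i and (i, j). *)
Record virtual_mesh Omega (X : point_cloud Omega) := VirtualMesh {
  edges : {set vert X * vert X};
  edges_sym : forall i j, (i, j) \in edges -> (j, i) \in edges;
  edges_irrefl : forall i, (i, i) \notin edges }.

(* [face_moment] and [field_moment] are relevant on edges only, and
   [bnd_moment] and [bnd_field_moment] on faces contained in gamma' only. *)
Record mmd_data Omega (X : point_cloud Omega) (gamma : set 'rV[R]_d)
    (nF : nat) := MMDData {
  cell_volume : vert X -> R;
  face_moment : vert X -> vert X -> 'rV[R]_nF;
  bnd_moment : vert X -> 'rV[R]_nF;
  field_moment : discrete_field X gamma -> vert X -> vert X -> 'rV[R]_nF;
  bnd_field_moment : discrete_field X gamma -> vert X -> 'rV[R]_nF }.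

Definition neighbours Omega (X : point_cloud Omega) (E : virtual_mesh X)
    (i : vert X) : {set vert X} :=
  [set j | (i, j) \in edges E]%SET.

Definition DIV Omega (X : point_cloud Omega) (E : virtual_mesh X)
    (gamma : set 'rV[R]_d) (nF : nat) (D : mmd_data X gamma nF)
    (n u : 'rV[R]_d -> 'rV[R]_d) (uh : discrete_field X gamma) (i : vert X)
    : R :=
  (cell_volume D i)^-1 *
  (\sum_(j in neighbours E i) dotv (field_moment D uh i j) (face_moment D i j)
   + (if `[< chi i (compl_part Omega gamma) = set0 >] then 0
      else dotv (bnd_field_moment D uh i) (bnd_moment D i))
   + surf_integral (chi i gamma) (fun y => dotv (u y) (n y))).

End point_clouds.

(* The filter "f p -> 0". *)
Definition vanishing {R : realType} {T : Type} (f : T -> R) : set_system T :=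
  filter_from [set e : R | 0 < e] (fun e => [set p | `|f p| < e]).

Lemma vanishing_filter {R : realType} {T : Type} (f : T -> R) :
  Filter (vanishing f).
Proof.
apply: filter_from_filter; first by exists 1 => /=.
move=> a b /= a0 b0; exists (Num.min a b) => /=.
  by rewrite lt_min a0.
by move=> p /=; rewrite lt_min => /andP[].
Qed.

Canonical vanishing_filter_on (R : realType) (T : Type) (f : T -> R) :=
  FilterType (vanishing f) (vanishing_filter f).

Definition bigO_as_vanishing {R : realType} {T : Type} (h f g : T -> R)
    : Prop :=
  let F := vanishing_filter_on h in (f : T -> R^o) =O_F (g : T -> R^o).

(* mu_i = O(h_X^d) as h_X -> 0 along a family of point clouds, uniformly in
   the cell index i: i is part of the argument of the Landau symbol. *)
Definition volumes_bigO {R : realType} {d : nat} {Omega : set 'rV[R]_d}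
    {L : Type} (X : L -> point_cloud Omega) (mu : forall l, vert (X l) -> R)
    : Prop :=
  bigO_as_vanishing
    (fun p : {l : L & vert (X l)} => fill_distance (X (tag p)))
    (fun p : {l : L & vert (X l)} => mu (tag p) (tagged p))
    (fun p : {l : L & vert (X l)} => fill_distance (X (tag p)) ^+ d).

(* Main.v *)
Require Import Defs.
From mathcomp Require Import all_boot all_order all_algebra.
From mathcomp Require Import all_classical all_reals all_analysis.
From mathcomp Require Import ring lra.
Import Order.TTheory GRing.Theory Num.Theory.
Import numFieldNormedType.Exports.
Local Open Scope classical_set_scope.
Local Open Scope ring_scope.

(** Multiplying the divergence by the cell volume leaves the total flux of the
    cell, so a sum over a set of cells is a sum of fluxes. The flux
    through a virtual face shared by two cells of the set occurs twice, once
    for each orientation, with the same field moment and opposite face moments;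
    these terms cancel ([sum_antisym_eq0]), and only the edges leaving the set
    and the boundary faces remain.

    The rest of the argument is about the boundary faces.
    - The divergence assigns a cell to [gamma] or to its complement through the
      position of the centroid, whereas the conservation law does so through
      the inclusion of the face. Both parts are unions of faces, distinct faces
      overlap in null sets and each face has positive measure; hence every face
      lies entirely in one of the two parts ([face_sub_parts]), the one that
      contains its centroid.
    - The divergence uses the normal field of the whole boundary, the
      conservation law the normal of each face. A set has at most one outward
      unit normal at a point ([outward_unit_normal_unique]), so the two fields
      agree almost everywhere on the face, and the fluxes are equal
      ([face_flux_normal]).
    - When [gamma] is the whole boundary, the integral over it is the sum of
      the integrals over the faces, which are almost disjoint
      ([Rintegral_bigcup_ae_disjoint]). *)

(** * Euclidean vectors and uniqueness of the normal *)

Section euclidean.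
Context {R : realType} {m : nat}.
Implicit Types v w : 'rV[R]_m.

Lemma dotvC v w : dotv v w = dotv w v.
Proof. by apply: eq_bigr => j _; rewrite mulrC. Qed.

Lemma dotvBl v v' w : dotv (v - v') w = dotv v w - dotv v' w.
Proof.
by rewrite /dotv -sumrB; apply: eq_bigr => j _; rewrite !mxE mulrBl.
Qed.

Lemma dotvZl a v w : dotv (a *: v) w = a * dotv v w.
Proof. by rewrite /dotv mulr_sumr; apply: eq_bigr => j _; rewrite mxE mulrA. Qed.

Lemma dotvNr v w : dotv v (- w) = - dotv v w.
Proof. by rewrite /dotv -sumrN; apply: eq_bigr => j _; rewrite mxE mulrN. Qed.

Lemma dotvv_ge0 v : 0 <= dotv v v.
Proof. by apply: sumr_ge0 => j _; rewrite -expr2 sqr_ge0. Qed.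

Lemma dotvv_eq0 v : dotv v v = 0 -> v = 0.
Proof.
move=> /eqP; rewrite psumr_eq0; last by move=> j _; rewrite -expr2 sqr_ge0.
move=> /allP v0; apply/rowP => j; rewrite mxE; apply/eqP.
by have := v0 j (mem_index_enum j); rewrite mulf_eq0 orbb.
Qed.

Lemma sqr_enorm v : enorm v ^+ 2 = dotv v v.
Proof. by rewrite sqr_sqrtr// dotvv_ge0. Qed.

Lemma enorm_gt0 v : v != 0 -> 0 < enorm v.
Proof.
move=> v0; rewrite sqrtr_gt0 lt_neqAle dotvv_ge0 andbT eq_sym.
by apply: contra_neq v0; exact: dotvv_eq0.
Qed.

Lemma enormZ a v : 0 <= a -> enorm (a *: v) = a * enorm v.
Proof.
move=> a0; rewrite /enorm dotvZl dotvC dotvZl mulrA -expr2 sqrtrM ?sqr_ge0//.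
by rewrite sqrtr_sqr ger0_norm.
Qed.

(** If [nu] and [nu'] were different, the direction [v := nu' - nu] would make
    an acute angle with [nu'] and an obtuse one with [nu], so that
    the points [y + t v], for small [t > 0], would lie both outside and inside
    [Omega]. *)
Lemma outward_unit_normal_unique (Omega : set 'rV[R]_m) y nu nu' :
  outward_unit_normal Omega y nu -> outward_unit_normal Omega y nu' ->
  nu = nu'.
Proof.
move=> [nu1 nuP] [nu'1 nu'P]; apply/eqP/negPn/negP => nunu'.
pose v := nu' - nu.
have N0 : 0 < enorm v by rewrite enorm_gt0// subr_eq0 eq_sym.
have nunu : dotv nu nu = 1 by rewrite -sqr_enorm nu1 expr1n.
have nu'nu' : dotv nu' nu' = 1 by rewrite -sqr_enorm nu'1 expr1n.
have vv : enorm v ^+ 2 = 2 - 2 * dotv nu nu'.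
  rewrite sqr_enorm /v dotvBl ![dotv _ (nu' - nu)]dotvC !dotvBl nunu nu'nu'.
  by rewrite (dotvC nu'); ring.
have vnu : dotv v nu = - (enorm v ^+ 2 / 2).
  by rewrite vv /v dotvBl nunu (dotvC nu'); field.
have vnu' : dotv v nu' = enorm v ^+ 2 / 2.
  by rewrite vv /v dotvBl nu'nu'; field.
(* [v / |v|] makes the scalar product [|v| / 2] with [nu']; the cones are given
   the smaller opening [|v| / 4], so that they contain the direction [v]. *)
have e0 : 0 < enorm v / 4 by rewrite divr_gt0.
have [r r0 rP] := nuP _ e0; have [r' r'0 r'P] := nu'P _ e0.
pose t := Num.min r r' / (2 * enorm v).
have t0 : 0 < t by rewrite divr_gt0 ?mulr_gt0// lt_min r0.
have tv : enorm (t *: v) = Num.min r r' / 2.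
  by rewrite enormZ ?ltW// /t; field; rewrite gt_eqF.
have m0 : 0 < Num.min r r' by rewrite lt_min r0.
have tvm : enorm (t *: v) < Num.min r r' by rewrite tv; lra.
have cone : enorm v / 4 * enorm (t *: v) < t * (enorm v ^+ 2 / 2).
  rewrite enormZ ?ltW// [ltLHS](_ : _ = t * (enorm v ^+ 2 / 4)); last by ring.
  by rewrite ltr_pM2l// ltr_pM2l ?exprn_gt0// ltf_pV2 ?posrE// ltr_nat.
have zy : y + t *: v - y = t *: v by rewrite addrC addKr.
have /= := rP (y + t *: v); have /= := r'P (y + t *: v).
rewrite zy !dotvZl vnu vnu' mulrN.
move: tvm; rewrite lt_min => /andP[tvr tvr'].
move=> /(_ tvr') [_ out] /(_ tvr) [inn _].
by apply: out => //; apply: inn; rewrite ltrN2.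
Qed.

End euclidean.

(** * Integrals over almost disjoint pieces *)

Section integration.
Context d (T : measurableType d) (R : realType).
Variable mu : {measure set T -> \bar R}.

(** As [mu] is complete, [g] inherits the measurability of [f]. This serves
    surface integrals, where the integrand written with the global normal field
    is integrable by hypothesis, while nothing is known about the one written
    with the normals of a single face. *)
Lemma ae_eq_Rintegral_complete (D : set T) (f g : T -> R) :
  measure_is_complete mu -> measurable D -> mu.-integrable D (EFin \o f) ->
  {ae mu, forall x, D x -> f x = g x} ->
  (\int[mu]_(x in D) f x)%R = (\int[mu]_(x in D) g x)%R.
Proof.
move=> cmu mD intf fg; congr fine.
have mf := measurable_int mu intf.
have fgE : ae_eq mu D (EFin \o f) (EFin \o g).
  by apply: filterS fg => x fgx Dx /=; rewrite fgx.
by apply: ae_eq_integral => //; exact: ae_measurable_fun cmu _ _ _ fgE mf.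
Qed.

Lemma negligible_bigcup_seq (I : choiceType) (s : seq I) (F : I -> set T) :
  (forall i, i \in s -> mu.-negligible (F i)) ->
  mu.-negligible (\bigcup_(i in [set` s]) F i).
Proof.
move=> negF; rewrite bigcup_seq big_seq.
by elim/big_ind : _ => //; [exact: negligible_set0|exact: negligibleU].
Qed.

Lemma Rintegral_setU_ae_disjoint (A B : set T) (f : T -> R) :
  measurable A -> measurable B -> mu (A `&` B) = 0%E ->
  mu.-integrable (A `|` B) (EFin \o f) ->
  (\int[mu]_(x in A `|` B) f x)%R =
  (\int[mu]_(x in A) f x)%R + (\int[mu]_(x in B) f x)%R.
Proof.
move=> mA mB AB0 intf.
have mBA : measurable (B `\` A) by exact: measurableD.
have mAB : measurable (A `&` B) by exact: measurableI.
have intB : mu.-integrable B (EFin \o f).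
  by apply: integrableS intf => //; exact: measurableU.
have intA : mu.-integrable A (EFin \o f).
  by apply: integrableS intf => //; exact: measurableU.
have AUB : A `|` B = A `|` (B `\` A) by rewrite setUDr setDv setD0.
have dA : [disjoint A & B `\` A] by rewrite disj_set2E setDIK.
rewrite AUB Rintegral_setU -?AUB//.
rewrite [in RHS]/Rintegral (negligible_integral mAB mB intB AB0).
by rewrite setDIr setDv setU0.
Qed.

Lemma Rintegral_bigcup_ae_disjoint (I : choiceType) (s : seq I)
    (F : I -> set T) (f : T -> R) :
  uniq s -> (forall i, i \in s -> measurable (F i)) ->
  (forall i j, i \in s -> j \in s -> i != j -> mu (F i `&` F j) = 0%E) ->
  mu.-integrable (\bigcup_(i in [set` s]) F i) (EFin \o f) ->
  (\int[mu]_(x in \bigcup_(i in [set` s]) F i) f x)%R =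
  \sum_(i <- s) (\int[mu]_(x in F i) f x)%R.
Proof.
elim: s => [|a s IH] /=.
  by move=> *; rewrite big_nil set_nil bigcup_set0 Rintegral_set0.
move=> /andP[asN us] mF F0.
have mFs i : i \in s -> measurable (F i).
  by move=> si; apply: mF; rewrite inE si orbT.
have mFa : measurable (F a) by apply: mF; rewrite mem_head.
have mU : measurable (\bigcup_(i in [set` s]) F i).
  by rewrite bigcup_seq big_seq; exact: bigsetU_measurable.
rewrite bigcup_seq !big_cons -bigcup_seq => intf.
rewrite Rintegral_setU_ae_disjoint//.
  rewrite IH//; first by move=> i j si sj; apply: F0; rewrite inE ?si ?sj orbT.
  by apply: integrableS intf => //; exact: measurableU.
apply/negligibleP; first exact: measurableI.
rewrite setI_bigcupr; apply: negligible_bigcup_seq => i si.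
apply/negligibleP; first exact: measurableI (mFs _ si).
apply: F0; rewrite ?mem_head// ?inE ?si ?orbT//.
by apply: contraNneq asN => ->.
Qed.

End integration.

(** * Faces and the splitting of the boundary *)

Section faces.
Context {R : realType} {d : nat} {Omega gamma : set 'rV[R]_d}.
Context {X : point_cloud Omega}.
Hypothesis hgamma : splits_boundary X gamma.

Lemma surface_measure_complete :
  measure_is_complete (surface_measure R d).
Proof. exact: measure_is_complete_caratheodory. Qed.

Lemma measurable_gamma : measurable (gamma : set (surf_space R d)).
Proof.
have [_ [J /fintype.subsetP JX ->] _] := hgamma.
rewrite [X in measurable X](_ : _ = \bigcup_(i in [set` enum J]) face i).
  rewrite bigcup_seq big_seq; apply: bigsetU_measurable => i.
  by rewrite mem_enum => /JX/face_measurable.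
by apply: eq_bigcupl; split => i /=; rewrite mem_enum.
Qed.

(** A face occurring in neither union would be covered by its intersections
    with the other faces, which are null sets, although having a centroid
    forces its measure to be positive. *)
Lemma face_sub_parts {i} : i \in bnd X ->
  face i `<=` gamma \/ face i `<=` compl_part Omega gamma.
Proof.
move=> iX; have [_ [J JX gammaE] [J' J'X gamma'E]] := hgamma.
have [iJ|iJ] := boolP (i \in J).
  by left; rewrite gammaE => y iy; exists i.
have [iJ'|iJ'] := boolP (i \in J').
  by right; rewrite gamma'E => y iy; exists i.
exfalso; have [/andP[+ _] _] := face_centroid iX.
suff /measure_negligible -> : (surface_measure R d).-negligible (face i).
- by rewrite ltxx.
- exact: face_measurable.
pose s := enum (J :|: J').
have sX j : j \in s -> j \in bnd X.
  rewrite mem_enum inE => /orP[]; exact/fintype.subsetP.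
have cover : face i `<=` \bigcup_(j in [set` s]) (face i `&` face j).
  move=> y iy; have : bdry Omega y by rewrite (faces_cover X); exists i.
  have [gy _|gy by_] := pselect (gamma y).
    move: gy; rewrite gammaE => -[j /= jJ jy]; exists j => //=.
    by rewrite mem_enum inE jJ.
  have : compl_part Omega gamma y by [].
  rewrite gamma'E => -[j /= jJ' jy]; exists j => //=.
  by rewrite mem_enum inE jJ' orbT.
apply: (@negligibleS _ (surf_space R d) _ _ _ _ cover).
apply: negligible_bigcup_seq => j js.
apply/negligibleP; first by apply: measurableI; apply: face_measurable => //;
  exact: sX.
apply: faces_disjoint => //; first exact: sX.
by apply: contraTneq js => <-; rewrite mem_enum inE negb_or iJ.
Qed.

Lemma face_sub_gammaE {i} : i \in bnd X -> (face i `<=` gamma) <-> gamma (pt i).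
Proof.
move=> iX; split; first by apply; exact: centroid_in_face.
by have [//|/(_ _ (centroid_in_face iX))[]] := face_sub_parts iX.
Qed.

Lemma face_sub_complE {i} : i \in bnd X ->
  (face i `<=` compl_part Omega gamma) <-> compl_part Omega gamma (pt i).
Proof.
move=> iX; split; first by apply; exact: centroid_in_face.
by have [/(_ _ (centroid_in_face iX)) + []|//] := face_sub_parts iX.
Qed.

Lemma interior_pt_notin_bdry {i} : open Omega -> i \notin bnd X ->
  ~ bdry Omega (pt i).
Proof. by move=> oOmega iX [_]; apply; apply: oOmega; exact: pt_interior. Qed.

End faces.

(** * Balance over a set of cells *)

(** Each internal edge is met twice, with opposite summands: a sum that is its
    own opposite vanishes. *)
Lemma sum_antisym_eq0 (R : numDomainType) (I : finType) (C : {set I})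
    (e : {set I * I}) (F : I -> I -> R) :
  (forall i j, (i, j) \in e -> (j, i) \in e) ->
  (forall i j, (i, j) \in e -> F i j = - F j i) ->
  \sum_(i in C) \sum_(j in C | (i, j) \in e) F i j = 0.
Proof.
move=> e_sym Fanti; set S := LHS.
have SN : S = - S.
  rewrite {1}/S (exchange_big_dep (mem C)) /=; last by move=> i j _ /andP[].
  rewrite /S -sumrN.
  apply: eq_bigr => j jC; rewrite -sumrN.
  apply: eq_big => [i|i /and3P[_ _ /Fanti//]].
  by rewrite jC /=; congr (_ && _); apply/idP/idP; exact: e_sym.
by apply/eqP; have := mulrn_eq0 S 2; rewrite mulr2n {1}SN addNr eqxx /= => <-.
Qed.

Section balance.
Context {R : realType} {d : nat} {Omega gamma : set 'rV[R]_d}.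
Context {n u : 'rV[R]_d -> 'rV[R]_d} {nF : nat}.
Hypothesis oOmega : open Omega.
Hypothesis hn : normal_field Omega (bdry Omega) n.
Hypothesis hu : (surface_measure R d).-integrable gamma
  (fun y => (dotv (u y) (n y))%:E).
Variables (X : point_cloud Omega) (E : virtual_mesh X).
Variable D : mmd_data X gamma nF.
Hypothesis hgamma : splits_boundary X gamma.

(** The normals in the two integrals are unrelated data; they agree almost
    everywhere on the face because both are outward unit normals there. *)
Lemma face_flux_normal i : i \in bnd X -> face i `<=` gamma ->
  surf_integral (face i) (fun y => dotv (u y) (n y)) =
  surf_integral (face i) (fun y => dotv (u y) (face_normal i y)).
Proof.
move=> iX ig; have mi := face_measurable iX.
apply: ae_eq_Rintegral_complete => //.
- exact: surface_measure_complete.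
- exact: integrableS (measurable_gamma hgamma) mi ig hu.
have ae_filter := ae_filter_ringOfSetsType (surface_measure R d).
apply: filterS2 hn (face_normalP iX) => y ny fny iy; congr dotv.
apply: outward_unit_normal_unique (ny _) (fny iy).
by rewrite (faces_cover X); exists i.
Qed.

(** A boundary cell has its centroid in [gamma] exactly when its whole face lies
    there, which turns the pointwise test in [chi] into the inclusions that
    index the sums of the conservation law. An interior cell contributes no
    boundary term, since its point is off the boundary of the open set
    [Omega]. *)
Lemma cell_balance uh i : 0 < cell_volume D i ->
  cell_volume D i * DIV E D n u uh i =
    \sum_(j in neighbours E i) dotv (field_moment D uh i j) (face_moment D i j)
    + (if (i \in bnd X) && `[< face i `<=` compl_part Omega gamma >]
       then dotv (bnd_field_moment D uh i) (bnd_moment D i) else 0)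
    + (if (i \in bnd X) && `[< face i `<=` gamma >]
       then surf_integral (face i) (fun y => dotv (u y) (face_normal i y))
       else 0).
Proof.
move=> mui; rewrite /DIV mulVKf ?gt_eqF// /chi.
have [iX|iX] := boolP (i \in bnd X); rewrite /=; last first.
  have npt := interior_pt_notin_bdry oOmega iX.
  have [gsub _ _] := hgamma.
  rewrite (asboolF (_ : ~ compl_part Omega gamma (pt i))); last by case.
  rewrite (asboolF (_ : ~ gamma (pt i))); last by move/gsub.
  by rewrite asboolT// /surf_integral Rintegral_set0.
rewrite -(asbool_equiv_eq (face_sub_complE hgamma iX)).
rewrite -(asbool_equiv_eq (face_sub_gammaE hgamma iX)).
have face0 : face i <> set0.
  by move=> f0; have := centroid_in_face iX; rewrite f0.
congr (_ + _ + _).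
- case: (asboolP (face i `<=` _)) => _; first by rewrite asboolF.
  by rewrite asboolT.
- case: asboolP => [ig|_]; first exact: face_flux_normal.
  by rewrite /surf_integral Rintegral_set0.
Qed.

Hypothesis mu_gt0 : forall i, 0 < cell_volume D i.
Hypothesis face_moment_anti : forall i j, (i, j) \in edges E ->
  face_moment D i j = - face_moment D j i.
Hypothesis field_moment_sym : forall uh i j, (i, j) \in edges E ->
  field_moment D uh i j = field_moment D uh j i.

(** In the sum of the cell balances, the edge terms split according to whether
    the neighbour is in [C]; those with both ends in [C] cancel in pairs. *)
Lemma local_conservation (C : {set vert X}) uh :
  \sum_(i in C) cell_volume D i * DIV E D n u uh i =
    \sum_(i in C) \sum_(j in neighbours E i | j \notin C)
       dotv (field_moment D uh i j) (face_moment D i j)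
    + \sum_(k in C | (k \in bnd X) &&
                     `[< face k `<=` compl_part Omega gamma >])
         dotv (bnd_field_moment D uh k) (bnd_moment D k)
    + \sum_(k in C | (k \in bnd X) && `[< face k `<=` gamma >])
         surf_integral (face k) (fun y => dotv (u y) (face_normal k y)).
Proof.
under eq_bigr do rewrite cell_balance//.
rewrite !big_split -!big_mkcondr /=; congr (_ + _ + _).
under eq_bigr do rewrite (bigID (mem C)) /=.
rewrite big_split /= [X in X + _](_ : _ = 0) ?add0r//.
rewrite -[RHS](@sum_antisym_eq0 _ _ C (edges E)
  (fun i j => dotv (field_moment D uh i j) (face_moment D i j))) //.
- by apply: eq_bigr => i _; apply: eq_bigl => j; rewrite inE andbC.
- exact: edges_sym.
- by move=> i j ij; rewrite field_moment_sym// face_moment_anti// dotvNr.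
Qed.

(** For the set of all cells there is no outgoing edge and, as [gamma] is the
    whole boundary, no face in its complement; the remaining face fluxes add up
    to the flux through the boundary because faces overlap in null sets. *)
Lemma global_conservation uh : gamma = bdry Omega ->
  \sum_i cell_volume D i * DIV E D n u uh i =
    surf_integral (bdry Omega) (fun y => dotv (u y) (n y)).
Proof.
move=> gE; have hu' := hu; rewrite gE in hu'.
have faceg i : i \in bnd X -> face i `<=` gamma.
  by move=> iX y iy; rewrite gE (faces_cover X); exists i.
rewrite (eq_bigl (mem [set: vert X]%SET)); last by move=> i; rewrite !inE.
rewrite local_conservation big1 ?add0r; last first.
  by move=> i _; rewrite big_pred0// => j; rewrite finset.in_setT andbF.
rewrite big_pred0 ?add0r; last first.
  move=> i; apply/negP => /and3P[_ iX /asboolP icompl].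
  have iy := centroid_in_face iX.
  by have [_] := icompl _ iy; apply; exact: faceg iy.
have bdE : bdry Omega = \bigcup_(i in [set` enum (bnd X)]) face i.
  by rewrite (faces_cover X); apply: eq_bigcupl; split => i /=; rewrite mem_enum.
rewrite bdE in hu' *.
rewrite /surf_integral Rintegral_bigcup_ae_disjoint ?enum_uniq//.
- rewrite big_enum /=; apply: eq_big => [i|i /and3P[_ iX _]].
    by rewrite inE /=; case: (boolP (i \in bnd X)) => //= /faceg/asboolP.
  by rewrite -/(surf_integral _ _) -face_flux_normal//; exact: faceg.
- by move=> i; rewrite mem_enum; exact: face_measurable.
- by move=> i j; rewrite !mem_enum; exact: faces_disjoint.
Qed.

End balance.

Theorem theorem1 (R : realType) (d : nat) (hd : d = 2%N \/ d = 3%N)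
  (Omega : set 'rV[R]_d) (hOmega : lipschitz_region Omega)
  (n : 'rV[R]_d -> 'rV[R]_d) (hn : normal_field Omega (bdry Omega) n)
  (gamma : set 'rV[R]_d)
  (u : 'rV[R]_d -> 'rV[R]_d)
  (hu : (surface_measure R d).-integrable gamma
          (fun y => (dotv (u y) (n y))%:E))
  (nF : nat) (hnF : (1 <= nF)%N)
  (L : Type) (X : L -> point_cloud Omega)
  (hgamma : forall l, splits_boundary (X l) gamma)
  (E : forall l, virtual_mesh (X l))
  (D : forall l, mmd_data (X l) gamma nF)
  (T1_pos : forall l i, 0 < cell_volume (D l) i)
  (T1_O : volumes_bigO (fun l => cell_volume (D l)))
  (T1_sum : forall l,
     (\sum_(i : vert (X l)) cell_volume (D l) i)%:E = lebesgue_outer Omega)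
  (T2 : forall l i j, (i, j) \in edges (E l) ->
     face_moment (D l) i j = - face_moment (D l) j i)
  (T3 : forall l (uh : discrete_field (X l) gamma) i j,
     (i, j) \in edges (E l) ->
     field_moment (D l) uh i j = field_moment (D l) uh j i) :
  forall l,
    (forall (C : {set vert (X l)}) (uh : discrete_field (X l) gamma),
       \sum_(i in C) cell_volume (D l) i * DIV (E l) (D l) n u uh i =
         \sum_(i in C) \sum_(j in neighbours (E l) i | j \notin C)
            dotv (field_moment (D l) uh i j) (face_moment (D l) i j)
         + \sum_(k in C | (k \in bnd (X l)) &&
                          `[< face k `<=` compl_part Omega gamma >])
              dotv (bnd_field_moment (D l) uh k) (bnd_moment (D l) k)
         + \sum_(k in C | (k \in bnd (X l)) && `[< face k `<=` gamma >])
              surf_integral (face k) (fun y => dotv (u y) (face_normal k y)))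
    /\
    (gamma = bdry Omega ->
     forall uh : discrete_field (X l) gamma,
       \sum_(i : vert (X l)) cell_volume (D l) i * DIV (E l) (D l) n u uh i =
         surf_integral (bdry Omega) (fun y => dotv (u y) (n y))).
Proof.
move=> l; have [oOmega _ _ _ _] := hOmega; split=> [C uh|gE uh].
  apply: (local_conservation oOmega hn hu) => //.
  - exact: T2.
  - exact: T3.
apply: (global_conservation oOmega hn hu) => //.
- exact: T2.
- exact: T3.
Qed.
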